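(* Let $\mathcal{E}$ be an $(\ell+1)$-depth elementary system with elementary set $\mathcal{V}$ and global group $(\mathcal{V},\cdot)$. For each $t\in\mathbf{Z}$, the map $\theta_v^t:\mathcal{V}\to\nabla_{0,0}^t(\mathcal{V})$, $\mathbf{v}\mapsto\nabla_{0,0}^t(\mathbf{v})$, is a homomorphism from $(\mathcal{V},\cdot)$ to $(\nabla_{0,0}^t(\mathcal{V}),\odot_{0,0}^t)$. The map $\theta_v=(\ldots,\theta_v^t,\theta_v^{t+1},\ldots)$ is a homomorphism from $(\mathcal{V},\cdot)$ to the direct product group $\cdots\times(\nabla_{0,0}^t(\mathcal{V}),\odot_{0,0}^t)\times(\nabla_{0,0}^{t+1}(\mathcal{V}),\odot_{0,0}^{t+1})\times\cdots$, and its image $V_s=\operatorname{im}\theta_v$, with the componentwise operation $\overline{\cdot}$, is a group system $(V_s,\overline{\cdot})$ with component groups $(\nabla_{0,0}^t(\mathcal{V}),\odot_{0,0}^t)$. The map $\theta_v:\mathcal{V}\to V_s$ is a bijection, and $(\mathcal{V},\cdot)\simeq\operatorname{im}\theta_v=(V_s,\overline{\cdot})$ under the assignment $\mathbf{v}\mapsto\theta_v(\mathbf{v})$.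
   Context: Let $\ell>0$ be an integer and, for $0\le k\le\ell$, $t\in\mathbf{Z}$, let $V_k^t$ be a nonempty set. The elementary set is $\mathcal{V}=\prod_{t\in\mathbf{Z}}\prod_{0\le k\le\ell}V_k^t$, with elements $\mathbf{v}=(v_k^t)$. Let $T_k^t=\{(m,t-j):0\le j\le\ell-k,\ k+j\le m\le\ell\}$, $\nabla_{0,k}^t(\mathbf{v})=(v_m^s)_{(m,s)\in T_k^t}$, and $\nabla_{0,k}^t(\mathcal{V})=\{\nabla_{0,k}^t(\mathbf{v}):\mathbf{v}\in\mathcal{V}\}$. An $(\ell+1)$-depth elementary system $\mathcal{E}$ is an elementary set $\mathcal{V}$ with groups $(\nabla_{0,k}^t(\mathcal{V}),\odot_{0,k}^t)$ for all $0\le k\le\ell$, $t\in\mathbf{Z}$, such that for each $0\le k<\ell$ and $t\in\mathbf{Z}$ the projections $\nabla_{0,k}^t(\mathbf{v})\mapsto\nabla_{0,k+1}^t(\mathbf{v})$ and $\nabla_{0,k}^t(\mathbf{v})\mapsto\nabla_{0,k+1}^{t-1}(\mathbf{v})$ are homomorphisms from $(\nabla_{0,k}^t(\mathcal{V}),\odot_{0,k}^t)$ to $(\nabla_{0,k+1}^t(\mathcal{V}),\odot_{0,k+1}^t)$ and $(\nabla_{0,k+1}^{t-1}(\mathcal{V}),\odot_{0,k+1}^{t-1})$. Its global group $(\mathcal{V},\cdot)$ is the group in which $\dot{\mathbf{v}}\cdot\ddot{\mathbf{v}}$ is the unique $\bar{\mathbf{v}}\in\mathcal{V}$ with $\nabla_{0,0}^t(\bar{\mathbf{v}})=\nabla_{0,0}^t(\dot{\mathbf{v}})\odot_{0,0}^t\nabla_{0,0}^t(\ddot{\mathbf{v}})$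 for all $t\in\mathbf{Z}$. A group system with component groups $A^t$ is a set of sequences $(a^t)_{t\in\mathbf{Z}}$, $a^t\in A^t$, forming a group under the componentwise operation. *)

(* Defs.v *)
From HB Require Import structures.
From mathcomp Require Import all_boot all_order all_algebra.
From mathcomp Require Import boolp classical_sets.

Set Implicit Arguments.
Unset Strict Implicit.
Unset Printing Implicit Defensive.

Import GRing.Theory.

Local Open Scope classical_set_scope.
Local Open Scope ring_scope.

Definition is_group (T : Type) (op : T -> T -> T) : Prop :=
  associative op /\
  exists e : T, [/\ left_id e op, right_id e op &
                    forall x, exists y, op y x = e /\ op x y = e].

(* [group_type gP] is [T] seen as a [groupType] whose product is [op]. *)
Definition group_type (T : Type) (op : T -> T -> T) (gP : is_group op) : Type :=
  T.

Section GroupType.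
Variables (T : Type) (op : T -> T -> T) (gP : is_group op).

Let one : T := sval (cid gP.2).
Let oneP := svalP (cid gP.2).
Let invP (x : T) : exists y, op y x = one /\ op x y = one.
Proof. by case: oneP => _ _; apply. Qed.
Let inv (x : T) : T := sval (cid (invP x)).

Let mul1g : left_id one op. Proof. by case: oneP. Qed.
Let mulg1 : right_id one op. Proof. by case: oneP. Qed.
Let mulVg : left_inverse one inv op.
Proof. by move=> x; case: (svalP (cid (invP x))). Qed.
Let mulgV : right_inverse one inv op.
Proof. by move=> x; case: (svalP (cid (invP x))). Qed.

HB.instance Definition _ := gen_eqMixin (group_type gP).
HB.instance Definition _ := gen_choiceMixin (group_type gP).
HB.instance Definition _ :=
  isGroup.Build (group_type gP) gP.1 mul1g mulg1 mulVg mulgV.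
End GroupType.

Section DirectProduct.
Variables (I : Type) (A : I -> groupType).

Definition componentwise_mul (a b : forall i, A i) : forall i, A i :=
  fun i => (a i * b i)%g.

Lemma componentwise_mul_group : is_group componentwise_mul.
Proof.
split=> [a b c|].
  by apply: functional_extensionality_dep => i; exact: mulgA.
exists (fun i => 1%g); split=> [a|a|a].
- by apply: functional_extensionality_dep => i; exact: mul1g.
- by apply: functional_extensionality_dep => i; exact: mulg1.
exists (fun i => (a i)^-1%g).
split; apply: functional_extensionality_dep => i.
- exact: mulVg.
- exact: mulgV.
Qed.

Definition direct_product : groupType := group_type componentwise_mul_group.
End DirectProduct.

Section GroupSystem.
Variables (A : int -> groupType) (S : set (direct_product A)).

(* A set of sequences that is a group under the componentwise operation: the
   operation restricts to S, and S with the restriction is a group. *)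
Definition componentwise_closed : Prop :=
  forall a b, a \in S -> b \in S -> componentwise_mul a b \in S.

Definition induced_mul (Smul : componentwise_closed) (a b : S) : S :=
  exist _ (componentwise_mul (val a) (val b)) (Smul _ _ (valP a) (valP b)).

Record is_group_system : Prop := GroupSystem {
  group_system_closed : componentwise_closed;
  group_system_group : is_group (induced_mul group_system_closed) }.

Definition group_system_groupType (gS : is_group_system) : groupType :=
  group_type (group_system_group gS).
End GroupSystem.
Arguments is_group_system : clear implicits.

Section ElementarySet.
Variables (ell : nat) (V : 'I_ell.+1 -> int -> Type).

Definition elementary_set : Type := forall (t : int) (k : 'I_ell.+1), V k t.

(* T_k^t as a set of pairs (m, s); the bound m <= ell is carried by the type
   'I_ell.+1. The index k is a nat, used only for k <= ell. *)
Definition triangle (k : nat) (t : int) : set ('I_ell.+1 * int) :=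
  [set p : 'I_ell.+1 * int | exists j : nat,
    [/\ (j <= ell - k)%N, (k + j <= p.1)%N & p.2 = t - j%:Z]].

Definition window (k : nat) (t : int) : Type :=
  forall p : triangle k t, V (val p).1 (val p).2.

Definition nabla (k : nat) (t : int) (v : elementary_set) : window k t :=
  fun p => v (val p).2 (val p).1.
Arguments nabla k t v : clear implicits.

(* nabla_{0,k}^t(V) is defined as an image. The coercion of a set to its type of
   elements makes it the carrier of a group. *)
Definition nabla_set (k : nat) (t : int) : set (window k t) :=
  range (nabla k t).
Arguments nabla_set k t : clear implicits.

Definition to_nabla (k : nat) (t : int) (v : elementary_set) : nabla_set k t :=
  exist _ (nabla k t v) (mem_set (imageT (nabla k t) v)).

(* Forgetting the entries outside triangle k' t' maps nabla_{0,k}^t(v) to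
   nabla_{0,k'}^{t'}(v); see nabla_proj_to_nabla. *)
Section Projection.
Variables (k k' : nat) (t t' : int).
Hypothesis sub : triangle k' t' `<=` triangle k t.

Definition triangle_incl (p : triangle k' t') : triangle k t :=
  exist _ (val p) (mem_set (sub (set_mem (valP p)))).

Definition restrict_window (w : window k t) : window k' t' :=
  fun p => w (triangle_incl p).

Lemma restrict_window_nabla (v : elementary_set) :
  restrict_window (nabla k t v) = nabla k' t' v.
Proof. by []. Qed.

Lemma restrict_window_in (w : nabla_set k t) :
  restrict_window (val w) \in nabla_set k' t'.
Proof. by apply/mem_set; case: (set_mem (valP w)) => v _ <-; exists v. Qed.

Definition nabla_proj (w : nabla_set k t) : nabla_set k' t' :=
  exist _ (restrict_window (val w)) (restrict_window_in w).

Lemma nabla_proj_to_nabla (v : elementary_set) :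
  nabla_proj (to_nabla k t v) = to_nabla k' t' v.
Proof. exact: val_inj. Qed.
End Projection.

Lemma triangle_sub_same (k : nat) (t : int) :
  triangle k.+1 t `<=` triangle k t.
Proof.
move=> p [j [jl kj pt]]; exists j; split=> //.
  by apply: leq_trans jl _; rewrite leq_sub2l.
by apply: leq_trans kj; rewrite leq_add2r.
Qed.

Lemma triangle_sub_prev (k : nat) (t : int) :
  triangle k.+1 (t - 1) `<=` triangle k t.
Proof.
move=> p [j [jl kj pt]]; exists j.+1; split; last 2 first.
- by rewrite addnS -addSn.
- by rewrite pt -addrA -opprD -PoszD add1n.
have kl : (k < ell)%N.
  rewrite -ltnS; apply: leq_ltn_trans (ltn_ord p.1).
  by apply: leq_trans kj; rewrite leq_addr.
by rewrite -(subnSK kl) ltnS.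
Qed.
End ElementarySet.
Arguments triangle : clear implicits.
Arguments nabla {ell V} k t v.
Arguments nabla_set {ell} V k t.
Arguments to_nabla {ell V} k t v.

(* For k : 'I_ell, [widen_ord (leqnSn ell) k] is k and [lift ord0 k] is k + 1
   as elements of 'I_ell.+1. *)
Record elementary_system (ell : nat) := ElementarySystem {
  component : 'I_ell.+1 -> int -> Type;
  component_inhabited : forall k t, inhabited (component k t);
  nabla_mul : forall (k : 'I_ell.+1) (t : int),
    nabla_set component k t -> nabla_set component k t ->
    nabla_set component k t;
  nabla_mul_group : forall (k : 'I_ell.+1) (t : int),
    is_group (@nabla_mul k t);
  nabla_proj_same : forall (k : 'I_ell) (t : int),
    {morph @nabla_proj ell component k k.+1 t t
       (@triangle_sub_same ell k t) :
       x y / @nabla_mul (widen_ord (leqnSn ell) k) t x y >->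
             @nabla_mul (lift ord0 k) t x y};
  nabla_proj_prev : forall (k : 'I_ell) (t : int),
    {morph @nabla_proj ell component k k.+1 t (t - 1)
       (@triangle_sub_prev ell k t) :
       x y / @nabla_mul (widen_ord (leqnSn ell) k) t x y >->
             @nabla_mul (lift ord0 k) (t - 1) x y} }.

Arguments nabla_mul {ell} e k t.
Arguments nabla_proj_same {ell} e k t.
Arguments nabla_proj_prev {ell} e k t.

Definition nabla_group (ell : nat) (E : elementary_system ell)
    (k : 'I_ell.+1) (t : int) : groupType :=
  group_type (nabla_mul_group E k t).

Section GlobalGroup.
Variables (ell : nat) (E : elementary_system ell).
Local Notation V := (elementary_set (component E)).

Definition is_global_product (v w u : V) : Prop :=
  forall t, to_nabla 0 t u =
    nabla_mul E ord0 t (to_nabla 0 t v) (to_nabla 0 t w).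

Lemma triangle0 (k : 'I_ell.+1) (t : int) : (k, t) \in triangle ell 0 t.
Proof. by apply/mem_set; exists 0%N; split; rewrite ?subr0. Qed.

Lemma to_nabla0_inj (u v : V) :
  (forall t, to_nabla 0 t u = to_nabla 0 t v) -> u = v.
Proof.
move=> uv; apply: functional_extensionality_dep => t.
apply: functional_extensionality_dep => k.
exact: (congr1 (fun f : nabla_set (component E) 0 t =>
  val f (exist _ (k, t) (triangle0 k t))) (uv t)).
Qed.

Section Gluing.
Variable a : forall (k : 'I_ell.+1) (t : int), nabla_group E k t.
Hypothesis a_same : forall (k : 'I_ell) t,
  nabla_proj (@triangle_sub_same ell k t) (a (widen_ord (leqnSn ell) k) t) =
  a (lift ord0 k) t.
Hypothesis a_prev : forall (k : 'I_ell) t,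
  nabla_proj (@triangle_sub_prev ell k t) (a (widen_ord (leqnSn ell) k) t) =
  a (lift ord0 k) (t - 1).

Let entry (k : 'I_ell.+1) t p (hp : p \in triangle ell k t) :
  component E p.1 p.2 := proj1_sig (a k t) (exist _ p hp).

Let entry_same (k : 'I_ell) t p hp hp' :
  @entry (widen_ord (leqnSn ell) k) t p hp = @entry (lift ord0 k) t p hp'.
Proof.
have /(congr1 val)/(congr1 (fun f => f (exist _ p hp'))) := a_same k t.
apply: etrans.
exact: (congr1 (@entry (widen_ord (leqnSn ell) k) t p) (bool_irrelevance hp _)).
Qed.

Let entry_prev (k : 'I_ell) t p hp hp' :
  @entry (widen_ord (leqnSn ell) k) t p hp = @entry (lift ord0 k) (t - 1) p hp'.
Proof.
have /(congr1 val)/(congr1 (fun f => f (exist _ p hp'))) := a_prev k t.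
apply: etrans.
exact: (congr1 (@entry (widen_ord (leqnSn ell) k) t p) (bool_irrelevance hp _)).
Qed.

Let entry0 (k : 'I_ell.+1) t p hp hp0 :
  k = 0%N :> nat -> @entry k t p hp = @entry ord0 t p hp0.
Proof.
move=> k0; have kE : k = ord0 by apply: val_inj.
by subst k; exact: (congr1 (@entry ord0 t p) (bool_irrelevance hp hp0)).
Qed.

Let entry_eq_same (j : nat) (k : 'I_ell.+1) t p hp hp0 :
  k = j :> nat -> @entry k t p hp = @entry ord0 t p hp0.
Proof.
elim: j k hp => [|j IHj] k hp kj; first exact: entry0.
have jl : (j < ell)%N by rewrite -ltnS -kj ltn_ord.
have kE : k = lift ord0 (Ordinal jl) by apply: val_inj; exact: kj.
subst k.
have hp' : p \in triangle ell (widen_ord (leqnSn ell) (Ordinal jl)) t.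
  apply: mem_set; apply: triangle_sub_same; exact: (set_mem hp).
by rewrite -(entry_same hp' hp) (IHj _ hp').
Qed.

Let entry_eq_prev (j : nat) (k : 'I_ell.+1) t s p hp hp0 :
  k = j :> nat -> s = t - j%:Z -> @entry k s p hp = @entry ord0 t p hp0.
Proof.
elim: j k s hp => [|j IHj] k s hp kj st.
  by rewrite subr0 in st; subst s; exact: entry0.
have jl : (j < ell)%N by rewrite -ltnS -kj ltn_ord.
have kE : k = lift ord0 (Ordinal jl) by apply: val_inj; exact: kj.
have sE : s = t - j%:Z - 1 by rewrite st -addrA -opprD -PoszD addn1.
clear st; subst k s.
have hp' : p \in triangle ell (widen_ord (leqnSn ell) (Ordinal jl)) (t - j%:Z).
  apply: mem_set; apply: triangle_sub_prev; exact: (set_mem hp).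
by rewrite -(entry_prev hp' hp) (IHj _ _ hp').
Qed.

Lemma nabla_glue : exists u : V, forall t, to_nabla 0 t u = a ord0 t.
Proof.
exists (fun t k => @entry ord0 t _ (triangle0 k t)) => t.
apply: val_inj; apply: functional_extensionality_dep => -[[m s] hp].
have [j /= [jl jm sE]] := set_mem hp.
pose k : 'I_ell.+1 := inord j.
have kj : k = j :> nat by rewrite inordK // ltnS (leq_trans jl) ?leq_subr.
have hk : (m, s) \in triangle ell k s.
  apply/mem_set; exists 0%N; split; rewrite ?subr0 //=.
  by rewrite addn0 kj.
rewrite /= /nabla /= -(entry_eq_same hk _ kj).
exact: (entry_eq_prev hk hp kj sE).
Qed.
End Gluing.

Lemma global_product (v w : V) : exists! u, is_global_product v w u.
Proof.
have [k t|k t|u uP] := @nabla_glue (fun k t => nabla_mul E k t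
    (to_nabla k t v) (to_nabla k t w)).
- by rewrite nabla_proj_same !nabla_proj_to_nabla.
- by rewrite nabla_proj_prev !nabla_proj_to_nabla.
by exists u; split=> // u' u'P; apply: to_nabla0_inj => t; rewrite uP u'P.
Qed.

Definition global_mul (v w : V) : V :=
  sval (cid (global_product v w)).

Lemma global_mulP (v w : V) : is_global_product v w (global_mul v w).
Proof. by case: (svalP (cid (global_product v w))). Qed.

Let proj_morph (k k' : 'I_ell.+1) t t'
    (f : nabla_group E k t -> nabla_group E k' t') :
  {morph f : x y / nabla_mul E k t x y >-> nabla_mul E k' t' x y} ->
  f 1%g = 1%g /\ {morph f : x / x^-1%g >-> x^-1%g}.
Proof.
move=> fM; have {}fM x y : f (x * y)%g = (f x * f y)%g by exact: fM.
have f1 : f 1%g = 1%g by apply: (mulgI (f 1%g)); rewrite -fM !mulg1.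
by split=> // x; apply: (mulgI (f x)); rewrite -fM !mulgV.
Qed.

Lemma global_one : exists e : V,
  forall t, to_nabla 0 t e = 1%g :> nabla_group E ord0 t.
Proof.
apply: (@nabla_glue (fun k t => 1%g)) => k t.
- by case: (@proj_morph (widen_ord (leqnSn ell) k) (lift ord0 k) t t _
    (nabla_proj_same E k t)).
- by case: (@proj_morph (widen_ord (leqnSn ell) k) (lift ord0 k) t (t - 1) _
    (nabla_proj_prev E k t)).
Qed.

Lemma global_inv (v : V) : exists u : V, forall t, to_nabla 0 t u =
  (to_nabla 0 t v : nabla_group E ord0 t)^-1%g :> nabla_group E ord0 t.
Proof.
apply: (@nabla_glue (fun k t =>
  (to_nabla k t v : nabla_group E k t)^-1%g)) => k t.
- case: (@proj_morph (widen_ord (leqnSn ell) k) (lift ord0 k) t t _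
    (nabla_proj_same E k t)) => _ ->.
  by rewrite nabla_proj_to_nabla.
- case: (@proj_morph (widen_ord (leqnSn ell) k) (lift ord0 k) t (t - 1) _
    (nabla_proj_prev E k t)) => _ ->.
  by rewrite nabla_proj_to_nabla.
Qed.

Lemma global_mul_group : is_group global_mul.
Proof.
split=> [u v w|].
  apply: to_nabla0_inj => t; rewrite !global_mulP.
  exact: (@mulgA (nabla_group E ord0 t)).
have [e eP] := global_one; exists e; split=> [v|v|v].
- apply: to_nabla0_inj => t; rewrite global_mulP eP.
  exact: (@mul1g (nabla_group E ord0 t)).
- apply: to_nabla0_inj => t; rewrite global_mulP eP.
  exact: (@mulg1 (nabla_group E ord0 t)).
have [u uP] := global_inv v; exists u.
split; apply: to_nabla0_inj => t; rewrite global_mulP eP uP.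
- exact: (@mulVg (nabla_group E ord0 t)).
- exact: (@mulgV (nabla_group E ord0 t)).
Qed.

Definition global_group : groupType := group_type global_mul_group.

Definition theta_at (t : int) : global_group -> nabla_group E ord0 t :=
  to_nabla 0 t.

Definition theta :
    global_group -> direct_product (fun t => nabla_group E ord0 t) :=
  fun v t => theta_at t v.

Definition theta_image :
    set (direct_product (fun t => nabla_group E ord0 t)) :=
  range theta.

Definition to_theta_image (v : global_group) : theta_image :=
  exist _ (theta v) (mem_set (imageT theta v)).
End GlobalGroup.
Arguments theta_at {ell} E t v.
Arguments theta {ell} E v.
Arguments theta_image {ell} E _.
Arguments to_theta_image {ell} E v.

(* Main.v *)
Require Import Defs.
From mathcomp Require Import all_boot all_order all_algebra.
From mathcomp Require Import boolp classical_sets.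

(** The global product is defined window by window, so [global_mulP] says that each [theta_at E t]
    is multiplicative; hence so is [theta E], coordinate by coordinate. Its image is therefore
    closed under the componentwise product and, as a surjective multiplicative image of the global
    group, is itself a group ([is_group_surj]). The windows at level 0 jointly contain every entry
    of a sequence ([to_nabla0_inj]), so [theta E] is injective, and the multiplicative bijection
    onto its image is an isomorphism. *)

Lemma morphM_monoid_morphism (G H : groupType) (f : G -> H) :
  {morph f : x y / (x * y)%g} -> monoid_morphism f.
Proof.
by move=> fM; split=> //; apply: (mulgI (f 1%g)); rewrite -fM !mulg1.
Qed.

(** Each group axiom lifts to [G] through preimages; the unit and inverses are the images of those
    of [G]. *)
Lemma is_group_surj (G : groupType) (T : Type) (op : T -> T -> T) (f : G -> T) :
  {morph f : x y / (x * y)%g >-> op x y} -> (forall y, exists x, f x = y) ->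
  is_group op.
Proof.
move=> fM fS; split=> [a b c|].
  have [[x <-] [y <-] [z <-]] := And3 (fS a) (fS b) (fS c).
  by rewrite -!fM mulgA.
exists (f 1%g); split=> a; have [x <-] := fS a; rewrite -?fM ?mul1g ?mulg1 //.
by exists (f x^-1%g); rewrite -!fM mulVg mulgV.
Qed.

Section Theta.
Variables (ell : nat) (E : elementary_system ell).

Lemma theta_atM (t : int) : {morph theta_at E t : x y / (x * y)%g}.
Proof. by move=> v w; exact: (global_mulP v w t). Qed.

Lemma thetaM : {morph theta E : x y / (x * y)%g}.
Proof.
by move=> v w; apply: functional_extensionality_dep => t; exact: theta_atM.
Qed.

Lemma theta_image_closed : componentwise_closed (theta_image E).
Proof.
move=> a b /set_mem[v _ <-] /set_mem[w _ <-]; apply/mem_set.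
by exists (v * w)%g => //; exact: thetaM.
Qed.

(** Stated for any closure proof, so that it applies both while the group system is being built and
    afterwards, to the closure proof stored in it. *)
Lemma to_theta_imageM (Smul : componentwise_closed (theta_image E)) :
  {morph to_theta_image E : x y / (x * y)%g >-> induced_mul Smul x y}.
Proof. by move=> v w; apply: val_inj; exact: thetaM. Qed.

Lemma to_theta_image_surj (a : theta_image E) :
  exists v, to_theta_image E v = a.
Proof.
by have [v _ va] := set_mem (valP a); exists v; apply: val_inj.
Qed.

Lemma theta_inj : injective (theta E).
Proof.
by move=> v w vw; apply: to_nabla0_inj => t; exact: (congr1 (fun f => f t) vw).
Qed.

Lemma to_theta_image_bij : bijective (to_theta_image E).
Proof.
pose g a := sval (cid (to_theta_image_surj a)).
have gK : cancel g (to_theta_image E).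
  by move=> a; exact: svalP (cid (to_theta_image_surj a)).
(* The chosen section [g] is a right inverse; injectivity makes it a left inverse too. *)
exists g => // v; apply: theta_inj; exact: (congr1 val (gK (to_theta_image E v))).
Qed.

Lemma theta_image_group_system : is_group_system _ (theta_image E).
Proof.
exists theta_image_closed.
exact: is_group_surj (to_theta_imageM _) to_theta_image_surj.
Qed.
End Theta.

Theorem theorem77 (ell : nat) (ell_gt0 : (0 < ell)%N)
    (E : elementary_system ell) :
  (forall t : int, monoid_morphism (theta_at E t)) /\
  monoid_morphism (theta E) /\
  exists VsP : is_group_system (fun t => nabla_group E ord0 t) (theta_image E),
    bijective (to_theta_image E) /\
    monoid_morphism
      (to_theta_image E : global_group E -> group_system_groupType VsP).
Proof.
split=> [t|]; first exact: morphM_monoid_morphism (theta_atM _ _ t).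
split; first exact: morphM_monoid_morphism (thetaM _ _).
exists (theta_image_group_system _ E); split; first exact: to_theta_image_bij.
by apply: morphM_monoid_morphism => v w; exact: to_theta_imageM.
Qed.
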